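(* Let $a\ge2$ and $k\ge0$ be integers and put $b=ak+1$ (the Fuss-Catalan case). Let $P$ be an $(a,b)$-Dyck path and $Q=\zeta(P)$. Let $v_1,\dots,v_{k+1}$ and $h_1,\dots,h_k$ be the lengths of the vertical and horizontal moves of the rational initial bounce path of $Q$, and write $|v|=v_1+\dots+v_{k+1}$ and $|h|=h_1+\dots+h_k$. Then the statistic $\delta(P)$ is determined by the initial bounce path of $Q$ by $$\delta(P)=|v|+|h|+1.$$
   Context: Let $a,b$ be relatively prime positive integers. An $(a,b)$-Dyck path is a lattice path from $(0,0)$ to $(b,a)$ with unit north steps and unit east steps, all of whose lattice points $(x,y)$ satisfy $ax\le by$; it is drawn in the grid with $a$ rows and $b$ columns. The level of the lattice point $(x,y)$ is $by-ax$. The levels of $P$ are the levels of the $a+b$ lattice points of $P$ other than the final point $(b,a)$ (these are distinct). $\delta(P)$ is the number of levels of $P$ that are less than $a+b$. Hooks and cores: the unit box with southeast corner $(x,y)$ has hook filling $by-ax$. The positive hooks of $P$ are the positive hook fillings of the boxes of the grid lying below (southeast of) $P$. $\mathfrak{c}(P)$ is the partition whose set of first-column hook lengths is the set of positive hooks of $P$ (it has no hook length equal to $a$ or $b$). For a partition $\kappa$ and a positive integer $m$: for each residue modulo $m$ occurring among the first-column hook lengths of $\kappa$ take the largest such hook length; the rows with these first-column hook lengths are the $m$-rows of $\kappa$; the $m$-boundary is the set of boxes with hook length less than $m$. Zeta: $\lambda(P)=(\lambda_1\ge\dots\ge\lambda_a)$ has as parts the numbers of $b$-boundary boxes in the $a$-rows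 of $\mathfrak{c}(P)$ (padded with zeros). $\zeta(P)$ is the $(a,b)$-Dyck path such that the boxes of the grid above (northwest of) it form the Young diagram of $\lambda(P)$ (English notation). Rational initial bounce path of an $(a,ak+r)$-Dyck path $Q$ (with $0\le k$, $0<r<a$; here $r=1$): a sequence of alternating $k+1$ vertical moves (lengths $v_1,\dots,v_{k+1}\ge0$) and $k$ horizontal moves (lengths $h_1,\dots,h_k$), starting at $(0,0)$ with a vertical move and ending with the $(k+1)$-th vertical move. For each $i$, from the current position move north $v_i$ steps until reaching an east step of $Q$ (i.e. until reaching the initial lattice point of the east step of $Q$ starting on the current vertical line); then, if $i\le k$, move east $h_i=v_1+\dots+v_i$ steps. *)

(* Defs.v *)
From mathcomp Require Import all_boot all_order all_algebra.
From mathcomp Require Import zify.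

Set Implicit Arguments.
Unset Strict Implicit.
Unset Printing Implicit Defensive.

(* A lattice path is the word of its steps, read from (0,0). *)
Definition step := bool.
Definition north : step := true.
Definition east : step := false.
Definition lattice_path := seq step.

Definition endpoint (P : lattice_path) : nat * nat :=
  (count_mem east P, count_mem north P).

Definition lattice_point (P : lattice_path) (i : nat) : nat * nat :=
  endpoint (take i P).

Definition dyck_path (a b : nat) (P : lattice_path) : bool :=
  (endpoint P == (b, a)) &&
  all (fun i => a * (lattice_point P i).1 <= b * (lattice_point P i).2)
      (iota 0 (size P).+1).

Definition level (a b : nat) (p : nat * nat) : int :=
  (b%:Z * p.2%:Z - a%:Z * p.1%:Z)%R.

Definition levels (a b : nat) (P : lattice_path) : seq int :=
  [seq level a b (lattice_point P i) | i <- iota 0 (size P)].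

Definition delta (a b : nat) (P : lattice_path) : nat :=
  count (fun l : int => (l < (a + b)%:Z)%R) (levels a b P).

(* Initial lattice points of the east steps of P. *)
Definition east_starts (P : lattice_path) : seq (nat * nat) :=
  [seq lattice_point P i | i <- iota 0 (size P) & nth north P i == east].

(* A unit box is named by its southeast corner (x, y): it is
   [x - 1, x] x [y, y + 1]. *)
Definition grid_boxes (a b : nat) : seq (nat * nat) :=
  [seq (x, y) | x <- iota 1 b, y <- iota 0 a].

Definition box_below (P : lattice_path) (c : nat * nat) : bool :=
  has (fun e : nat * nat => (e.1.+1 == c.1) && (c.2 < e.2)) (east_starts P).

Definition box_above (P : lattice_path) (c : nat * nat) : bool :=
  has (fun e : nat * nat => (e.1.+1 == c.1) && (e.2 <= c.2)) (east_starts P).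

(* The hook filling of a box is the level of its southeast corner. *)
Definition positive_hooks (a b : nat) (P : lattice_path) : seq nat :=
  [seq `|level a b c|%N
     | c <- grid_boxes a b & box_below P c && (0 < level a b c)%R].

Definition is_partition (kappa : seq nat) : bool :=
  sorted geq kappa && all (leq 1) kappa.

(* Rows and columns of a partition are numbered from 0; the box (i, j) lies in
   the diagram when j < nth 0 kappa i. *)
Definition hook_length (kappa : seq nat) (i j : nat) : nat :=
  (nth 0 kappa i - j.+1) + count (fun p => j < p) (drop i.+1 kappa) + 1.

Definition first_column_hooks (kappa : seq nat) : seq nat :=
  [seq hook_length kappa i 0 | i <- iota 0 (size kappa)].

(* For s strictly decreasing, the partition whose list of first-column hook
   lengths is s: see [first_column_hooksK]. *)
Fixpoint partition_of_hooks (s : seq nat) : seq nat :=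
  if s is h :: s' then (h - size s') :: partition_of_hooks s' else [::].

Definition core (a b : nat) (P : lattice_path) : seq nat :=
  partition_of_hooks (sort geq (undup (positive_hooks a b P))).

Definition m_rows (m : nat) (kappa : seq nat) : seq nat :=
  [seq i <- iota 0 (size kappa)
     | all (fun i' => (hook_length kappa i' 0 == hook_length kappa i 0 %[mod m])
                      ==> (hook_length kappa i' 0 <= hook_length kappa i 0))
           (iota 0 (size kappa))].

Definition m_boundary_in_row (m : nat) (kappa : seq nat) (i : nat) : nat :=
  count (fun j => hook_length kappa i j < m) (iota 0 (nth 0 kappa i)).

Definition zeta_partition (a b : nat) (P : lattice_path) : seq nat :=
  let kappa := core a b P in
  let s := sort geq [seq m_boundary_in_row b kappa i | i <- m_rows a kappa] in
  s ++ nseq (a - size s) 0.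

(* The path from (x, 0) to the vertical line at b that has, from bottom to top,
   its north steps at the abscissas listed in r. *)
Fixpoint path_of_rows (b x : nat) (r : seq nat) : lattice_path :=
  if r is l :: r' then nseq (l - x) east ++ north :: path_of_rows b l r'
  else nseq (b - x) east.

(* In English notation the first part is the top row: see
   [box_above_path_of_partition]. *)
Definition path_of_partition (b : nat) (lambda : seq nat) : lattice_path :=
  path_of_rows b 0 (rev lambda).

Definition zeta (a b : nat) (P : lattice_path) : lattice_path :=
  path_of_partition b (zeta_partition a b P).

(* v and h list the lengths of the vertical and horizontal moves.  After its
   (i+1)-th vertical move the bounce path is at
   (h_1 + ... + h_i, v_1 + ... + v_(i+1)). *)
Definition initial_bounce_path (k : nat) (Q : lattice_path) (v h : seq nat) :=
  [/\ size v = k.+1,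
      size h = k,
      forall i, i < k.+1 ->
        (sumn (take i h), sumn (take i.+1 v)) \in east_starts Q
    & forall i, i < k -> nth 0 h i = sumn (take i.+1 v)].

Lemma first_column_hooks_cons (l : nat) (kappa : seq nat) :
  first_column_hooks (l :: kappa) =
  (l - 1 + count (leq 1) kappa + 1) :: first_column_hooks kappa.
Proof.
rewrite /first_column_hooks /= {1}/hook_length /= drop0; congr cons.
by rewrite (iotaDl 1 0) -map_comp; apply: eq_map.
Qed.

Lemma first_column_hooksK (s : seq nat) :
  sorted gtn s -> all (leq 1) s ->
  is_partition (partition_of_hooks s) /\
  first_column_hooks (partition_of_hooks s) = s.
Proof.
have szE t : size (partition_of_hooks t) = size t by elim: t => //= ? ? ->.
elim: s => [//|x s IH] /= xs /andP[x0 s0].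
have [/andP[ss s1] fE] := IH (path_sorted xs) s0.
have ltx : size s < x.
  move: xs s0 x0; clear; elim: s x => //= y s IH x /andP[yx ys] /andP[y0 s0] x0.
  exact: leq_ltn_trans (IH y ys s0 y0) yx.
split; last first.
  rewrite first_column_hooks_cons fE; congr cons.
  move: s1; rewrite all_count => /eqP ->; rewrite szE; lia.
rewrite /is_partition /= s1 andbT subn_gt0 ltx andbT.
case: s xs ss {IH s0 s1 fE} ltx => //= y s /andP[yx _] -> _.
by rewrite andbT; lia.
Qed.

Lemma coreP (a b : nat) (P : lattice_path) :
  is_partition (core a b P) /\
  first_column_hooks (core a b P) = sort geq (undup (positive_hooks a b P)).
Proof.
have geqT : total geq by move=> x y /=; exact: leq_total.
apply: first_column_hooksK.
- by rewrite gtn_sorted_uniq_geq sort_uniq undup_uniq sort_sorted.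
- rewrite all_sort; apply/allP => x; rewrite mem_undup => /mapP[c].
  by rewrite mem_filter => /andP[/andP[_ c0] _] ->; rewrite absz_gt0; lia.
Qed.

Lemma east_starts_cons (s : step) (P : lattice_path) :
  east_starts (s :: P) =
  (if s == east then [:: (0, 0)] else [::]) ++
  [seq (if s == east then (e.1.+1, e.2) else (e.1, e.2.+1))
     | e <- east_starts P].
Proof.
rewrite /east_starts /= (iotaDl 1 0) filter_map -map_comp.
by case: s => /=; rewrite -map_comp; [|congr cons]; apply: eq_map => i.
Qed.

Lemma box_above_east (n : nat) (P : lattice_path) (x y : nat) :
  box_above (nseq n east ++ P) (x, y) =
  ((0 < x) && (x <= n)) || (n < x) && box_above P (x - n, y).
Proof.
elim: n x => [|n IH] x /=.
  rewrite subn0; case: x => //=; rewrite /box_above.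
  by elim: (east_starts P).
rewrite {1}/box_above east_starts_cons /= has_map.
case: x => [|x] /=.
  by elim: (east_starts _).
rewrite eqSS subSS ltnS; case: x => [//|x] /=.
rewrite -(IH x.+1).
by apply: eq_has => e /=; rewrite eqSS.
Qed.

Lemma box_above_north (P : lattice_path) (x y : nat) :
  box_above (north :: P) (x, y) = (0 < y) && box_above P (x, y.-1).
Proof.
rewrite /box_above east_starts_cons /= has_map.
case: y => [|y] /=; last exact: eq_has.
by elim: (east_starts P) => //= e s ->; rewrite andbF.
Qed.

Lemma box_above_path_of_rows (b z : nat) (r : seq nat) (x y : nat) :
  path leq z r -> all (geq b) r -> y < size r -> 0 < x <= b - z ->
  box_above (path_of_rows b z r) (x, y) = (x + z <= nth 0 r y).
Proof.
elim: r z x y => //= l r IH z x y /andP[zl lr] /andP[lb rb] yr /andP[x0 xb].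
rewrite box_above_east box_above_north x0 /=.
case: (leqP x (l - z)) => xl /=.
  case: y yr => [|y] yr /=; first by lia.
  suff : l <= nth 0 r y by lia.
  move: lr; rewrite (path_sortedE leq_trans) => /andP[/allP ar _].
  by apply: ar; exact: mem_nth.
case: y yr => [|y] yr /=; first by lia.
by rewrite IH //; [congr (_ <= _)|]; lia.
Qed.

Lemma box_above_path_of_partition (b : nat) (lambda : seq nat) (x y : nat) :
  sorted geq lambda -> all (geq b) lambda ->
  y < size lambda -> 0 < x <= b ->
  box_above (path_of_partition b lambda) (x, y) =
  (x <= nth 0 lambda (size lambda - y.+1)).
Proof.
move=> ls lb yl xb; rewrite box_above_path_of_rows ?subn0 ?size_rev //.
- by rewrite addn0 nth_rev.
- by rewrite path_min_sorted ?rev_sorted //; apply/allP.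
- by rewrite all_rev.
Qed.

Lemma size_m_rows (m : nat) (kappa : seq nat) :
  0 < m -> uniq (first_column_hooks kappa) -> size (m_rows m kappa) <= m.
Proof.
move=> m0 uf; pose f i := hook_length kappa i 0 %% m.
have fI : {in m_rows m kappa &, injective f}.
  move=> i j; rewrite !mem_filter => /andP[/allP iP iK] /andP[/allP jP jK] fij.
  have ij : hook_length kappa i 0 = hook_length kappa j 0.
    apply/eqP; rewrite eqn_leq (implyP (jP i iK)) ?(implyP (iP j jK)) //.
      by apply/eqP.
    by apply/eqP.
  move: iK jK; rewrite !mem_iota /= !add0n => iK jK.
  apply/eqP; rewrite -(nth_uniq 0 _ _ uf) ?size_map ?size_iota //; apply/eqP.
  by rewrite !(nth_map 0) ?size_iota // !nth_iota // ij.
rewrite -(size_map f) -[leqRHS](size_iota 0) uniq_leq_size //.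
  by rewrite map_inj_in_uniq // filter_uniq // iota_uniq.
by move=> _ /mapP[i _ ->]; rewrite mem_iota ltn_mod.
Qed.

Lemma m_boundary_in_row_le (m : nat) (kappa : seq nat) (i : nat) :
  m_boundary_in_row m kappa i <= m.
Proof.
rewrite /m_boundary_in_row -size_filter -(size_map (hook_length kappa i)).
rewrite -[leqRHS](size_iota 0) uniq_leq_size //; last first.
  move=> _ /mapP[j + ->].
  by rewrite mem_filter [in X in _ -> X]mem_iota => /andP[].
have lt_hook j j' : j < j' < nth 0 kappa i ->
    hook_length kappa i j' < hook_length kappa i j.
  move=> jj; suff : count (fun p => j' < p) (drop i.+1 kappa)
      <= count (fun p => j < p) (drop i.+1 kappa) by rewrite /hook_length; lia.
  by apply: sub_count => p /=; lia.
rewrite map_inj_in_uniq ?filter_uniq ?iota_uniq // => j j'.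
rewrite !mem_filter !mem_iota => /andP[_ jK] /andP[_ jK'] e.
case: (ltngtP j j') => // jj.
  by have := lt_hook j j'; rewrite e; lia.
by have := lt_hook j' j; rewrite e; lia.
Qed.

Lemma zeta_partitionP (a b : nat) (P : lattice_path) : 0 < a ->
  [/\ size (zeta_partition a b P) = a, sorted geq (zeta_partition a b P)
    & all (geq b) (zeta_partition a b P)].
Proof.
move=> a0; rewrite /zeta_partition; set s := sort _ _.
have sa : size s <= a.
  rewrite size_sort size_map size_m_rows // (coreP a b P).2.
  by rewrite sort_uniq undup_uniq.
split.
- by rewrite size_cat size_nseq subnKC.
- rewrite sorted_pairwise; last by move=> x y z /=; lia.
  rewrite pairwise_cat; apply/and3P; split.
  + by apply/allrelP => x y _ /nseqP[-> _].
  + rewrite -sorted_pairwise; last by move=> x y z /=; lia.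
    by apply: sort_sorted => x y /=; exact: leq_total.
  + by elim: (a - _) => //= n ->; rewrite andbT; apply/allP => x /nseqP[->].
- rewrite all_cat all_nseq orbT andbT all_sort; apply/allP => _ /mapP[i _ ->].
  exact: m_boundary_in_row_le.
Qed.

Lemma endpoint_path_of_rows (b z : nat) (r : seq nat) :
  path leq z r -> all (geq b) r -> z <= b ->
  endpoint (path_of_rows b z r) = (b - z, size r).
Proof.
rewrite /endpoint; elim: r z => [|l r IH] z /=.
  by rewrite !count_nseq /= mul0n mul1n.
move=> /andP[zl lr] /andP[lb rb] zb.
have [] := IH l lr rb lb; rewrite !count_cat !count_nseq /= => -> ->.
by congr pair; lia.
Qed.

Lemma endpoint_zeta (a b : nat) (P : lattice_path) :
  0 < a -> endpoint (zeta a b P) = (b, a).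
Proof.
move=> a0; have [sa ls lb] := zeta_partitionP b P a0.
rewrite endpoint_path_of_rows ?subn0 ?size_rev ?sa //.
- by rewrite path_min_sorted ?rev_sorted //; apply/allP.
- by rewrite all_rev.
Qed.

Lemma east_starts_ex (P : lattice_path) (x : nat) :
  x < (endpoint P).1 ->
  exists2 y, y <= (endpoint P).2 & (x, y) \in east_starts P.
Proof.
elim: P x => [//|s P IH] x; rewrite east_starts_cons /endpoint /=.
case: s => /=; rewrite ?add0n ?add1n => xP.
  have [y yP yE] := IH x xP; exists y.+1 => //.
  by apply/mapP; exists (x, y).
case: x xP => [|x] xP; first by exists 0.
have [y yP yE] := IH x xP; exists y => //.
by rewrite inE; apply/orP; right; apply/mapP; exists (x, y).
Qed.

Lemma east_starts_mono (P : lattice_path) (x y x' y' : nat) :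
  (x, y) \in east_starts P -> (x', y') \in east_starts P -> x <= x' -> y <= y'.
Proof.
elim: P x y x' y' => [//|s P IH] x y x' y'; rewrite east_starts_cons.
case: s => /=.
  by case/mapP=> -[u w] uw [-> ->] /mapP[[u' w'] uw' [-> ->]]; exact: IH uw uw'.
rewrite !inE => /orP[/eqP[-> ->] //|/mapP[[u w] uw [-> ->]]].
by case/orP=> [/eqP[-> ->] //|/mapP[[u' w'] uw' [-> ->]]]; exact: IH uw uw'.
Qed.

Lemma initial_bounce_path_exists (a k : nat) (Q : lattice_path) :
  endpoint Q = (a * k + 1, a) ->
  exists v h : seq nat, initial_bounce_path k Q v h.
Proof.
move=> eQ.
suff H n : n <= k -> exists v h,
    [/\ initial_bounce_path n Q v h, sumn v <= a & sumn h <= a * n].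
  by have [v [h [? _ _]]] := H k (leqnn k); exists v, h.
elim: n => [_|n IH nk].
  have [|y ya yE] := @east_starts_ex Q 0; first by rewrite eQ addn1.
  exists [:: y], [::]; rewrite /= addn0; rewrite eQ in ya; split=> //.
  by split=> // -[|//] _; rewrite /= addn0.
have [v [h [[sv sh vE hE] va ha]]] := IH (ltnW nk).
have [|y ya yE] := @east_starts_ex Q (sumn h + sumn v).
  by rewrite eQ /=; nia.
rewrite eQ /= in ya.
have vy : sumn v <= y.
  have := vE n (ltnSn n); rewrite !take_oversize ?sv ?sh // => E.
  by apply: east_starts_mono E yE _; rewrite leq_addr.
exists (rcons v (y - sumn v)), (rcons h (sumn v)).
rewrite !sumn_rcons subnKC //; split=> //; last by nia.
split; rewrite ?size_rcons ?sv ?sh //.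
- move=> i; rewrite ltnS leq_eqVlt => /orP[/eqP ->|i_n].
    by rewrite !take_oversize ?size_rcons ?sv ?sh // !sumn_rcons subnKC.
  rewrite -!cats1 !takel_cat ?sv ?sh //; exact: vE.
- move=> i; rewrite ltnS leq_eqVlt => /orP[/eqP ->|i_n].
    by rewrite nth_rcons sh ltnn eqxx -cats1 takel_cat ?sv // take_oversize ?sv.
  rewrite nth_rcons sh i_n -cats1 takel_cat ?sv 1?ltnW //; exact: hE.
Qed.

(* Main.v *)
Require Import Defs.
From mathcomp Require Import all_boot all_order all_algebra.
From mathcomp Require Import zify.

Set Implicit Arguments.
Unset Strict Implicit.
Unset Printing Implicit Defensive.

(** Both sides of the identity count gaps, that is, natural numbers outside the
    set H of positive hooks of P.

    The set H is closed under subtracting a and b as long as the result is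
    nonnegative, and it never contains 0 ([core_hooks]): in the grid,
    subtracting a or b from a hook moves the box one step east or south, and
    it stays below P.  In particular no multiple of a or b is a hook.

    The levels of P that are less than a + b are exactly the gaps below a + b
    ([delta_gaps]).  A level is never a hook: a box below P has its southeast
    corner off P, and a and b being coprime, no other grid point interferes.
    Conversely, for b = a k + 1 every
    n < a + b is the level of some point (x, y) of the grid; if that point is
    northwest of P then n is at least a + b, and if it is southeast of P then n
    is a hook or 0, so a positive gap n sits on P; the gap 0 is the level of the
    origin.

    On the other side, as for the beads of an abacus, in the row with first-column hook h, the hook lengths are the
    numbers h - g for g < h a gap ([column_gap_perm]).  Hence the part of
    lambda(P) for that row is the number of gaps among the b - 1 = a k integers
    before h.  Write N for the number of gaps in
    [1, a i], with i <= k.  This part is at most N if and only if h <= a i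
    ([boundary_gaps_le]); the point is the case h >= b, where the window of
    length a k before h contains strictly more gaps than [1, a k]
    ([gaps_shift_lt]).  The rows that count are those whose h is the largest
    in its residue class modulo a, and such h beyond a i correspond to the
    hooks in the window of length a after a i ([count_top_hooks]), so the
    number of parts that are at most N, padding zeros included, is the number
    of gaps in [a i + 1, a (i + 1)] ([count_zeta_partition]).

    The number of parts of lambda(P) that are at most x is the height of
    zeta(P) above the abscissa x.  So, by induction, after i horizontal moves
    the bounce path is at abscissa the number of gaps in [1, a i] and climbs
    to height the number of gaps in [a i + 1, a (i + 1)].  The final abscissa
    and height add up to the number of gaps in [1, a (k + 1)], and
    a (k + 1) = a + b - 1; the remaining 1 is the gap 0. *)

(** * Hook lengths of a partition given by its first column *)

Lemma size_partition_of_hooks (s : seq nat) :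
  size (partition_of_hooks s) = size s.
Proof. by elim: s => //= h s ->. Qed.

Lemma drop_partition_of_hooks (i : nat) (s : seq nat) :
  drop i (partition_of_hooks s) = partition_of_hooks (drop i s).
Proof. by elim: s i => [|h s IH] [|i] //=. Qed.

(** The j-th natural number outside [s], when [s] lists first-column hooks:
    it exceeds j by the number of elements of [s] below it, which belong to
    the rows too short to reach column j. *)
Definition column_gap (s : seq nat) (j : nat) : nat :=
  j + count (fun p => p <= j) (partition_of_hooks s).

Lemma column_gap_notin (s : seq nat) (j : nat) :
  sorted gtn s -> all (leq 1) s -> column_gap s j \notin s.
Proof.
rewrite /column_gap; elim: s j => [//|x s IH] j xs x0s.
have [/andP[ps _] _] := first_column_hooksK xs x0s.
have lex : {in s, forall y, y < x}.
  move: xs; rewrite /= path_sortedE; last by move=> ? ? ? /=; lia.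
  by move=> /andP[/allP].
have := IH j (path_sorted xs); rewrite inE negb_or.
have -> : all (leq 1) s by case/andP: x0s.
have szc := count_size (fun p => p <= j) (partition_of_hooks s).
rewrite size_partition_of_hooks in szc.
(* If x - size s <= j, every row is too short and the gap lies beyond x. *)
move=> /(_ isT) /=; case: (leqP (x - size s) j) => xj js; last first.
  by rewrite add0n js andbT; apply/eqP; lia.
have -> : count (fun p => p <= j) (partition_of_hooks s) = size s.
  rewrite -size_partition_of_hooks; apply/eqP; rewrite -all_count.
  move: ps; rewrite /= path_sortedE; last by move=> ? ? ? /=; lia.
  by case/andP=> /allP H _; apply/allP => p /H /= ?; lia.
apply/andP; split; first by apply/eqP; lia.
by apply/negP => /lex; lia.
Qed.

(** The gaps below [h] are the [column_gap]s of the columns of the row of [h]: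
    these are distinct gaps below [h], and there are [h - size s] of both. *)
Lemma column_gap_perm (h : nat) (s : seq nat) :
  sorted gtn (h :: s) -> all (leq 1) (h :: s) ->
  perm_eq [seq column_gap s j | j <- iota 0 (h - size s)]
          [seq g <- iota 0 h | g \notin s].
Proof.
move=> hs h0s; have ss := path_sorted hs.
have s0 : all (leq 1) s by case/andP: h0s.
have us : uniq s by move: ss; rewrite gtn_sorted_uniq_geq => /andP[].
have lth : {in s, forall y, y < h}.
  move: hs; rewrite /= path_sortedE; last by move=> ? ? ? /=; lia.
  by move=> /andP[/allP].
have lt_gap j j' : j < j' -> column_gap s j < column_gap s j'.
  move=> jj; rewrite /column_gap -addSn leq_add //.
  by apply: sub_count => p /=; lia.
have gap_inj : injective (column_gap s).
  move=> j j' e; case: (ltngtP j j') => // /lt_gap; rewrite e ltnn //.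
have u1 : uniq [seq column_gap s j | j <- iota 0 (h - size s)].
  by rewrite map_inj_uniq // iota_uniq.
have sub : {subset [seq column_gap s j | j <- iota 0 (h - size s)]
             <= [seq g <- iota 0 h | g \notin s]}.
  move=> _ /mapP[j + ->]; rewrite mem_iota mem_filter mem_iota.
  rewrite column_gap_notin //= !add0n => jh.
  have := count_size (fun p => p <= j) (partition_of_hooks s).
  by rewrite size_partition_of_hooks /column_gap; lia.
have [|_ e] := uniq_min_size u1 sub.
  rewrite size_map size_iota size_filter.
  have := count_predC (mem s) (iota 0 h); rewrite size_iota.
  have -> : count (mem s) (iota 0 h) = size s.
    rewrite -size_filter; apply: perm_size; apply: uniq_perm => //.
      by rewrite filter_uniq ?iota_uniq.
    move=> y; rewrite mem_filter mem_iota /=.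
    by apply/andP/idP => [[]//|ys]; rewrite ys lth.
  rewrite (eq_count (a2 := fun g => g \notin s)) //; lia.
by apply: uniq_perm => //; rewrite filter_uniq ?iota_uniq.
Qed.

Lemma nth_first_column (s : seq nat) (i : nat) :
  sorted gtn s -> all (leq 1) s -> i < size s ->
  hook_length (partition_of_hooks s) i 0 = nth 0 s i.
Proof.
move=> ss s0 ltis; have [_ e] := first_column_hooksK ss s0.
rewrite -{2}e (nth_map 0) ?size_iota ?size_partition_of_hooks //.
by rewrite nth_iota ?size_partition_of_hooks.
Qed.

(** The m-boundary boxes of the row with first-column hook [h]: its hook lengths
    are the [h - g]. *)
Definition boundary_gaps (m : nat) (s : seq nat) (h : nat) : nat :=
  count (fun g => (h - g < m) && (g \notin s)) (iota 0 h).

Lemma m_boundary_in_rowE (m : nat) (s : seq nat) (i : nat) :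
  sorted gtn s -> all (leq 1) s -> i < size s ->
  m_boundary_in_row m (partition_of_hooks s) i = boundary_gaps m s (nth 0 s i).
Proof.
move=> ss s0 ltis; set h := nth 0 s i; set s' := drop i.+1 s.
have ds : drop i s = h :: s' by rewrite (drop_nth 0).
have sd : sorted gtn (h :: s') by rewrite -ds drop_sorted.
have s0d : all (leq 1) (h :: s').
  by apply/allP => x; rewrite -ds => /mem_drop; exact: (allP s0).
have row : nth 0 (partition_of_hooks s) i = h - size s'.
  by rewrite -[i]addn0 -nth_drop drop_partition_of_hooks ds.
rewrite /m_boundary_in_row row /boundary_gaps.
transitivity (count (fun g => h - g < m)
    [seq column_gap s' j | j <- iota 0 (h - size s')]).
  rewrite count_map; apply: eq_in_count => j; rewrite mem_iota => jh /=.
  rewrite /hook_length row drop_partition_of_hooks -/s' /column_gap.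
  have := count_predC (fun p => p <= j) (partition_of_hooks s').
  rewrite size_partition_of_hooks (eq_count (a1 := predC _) (a2 := fun p => j < p)).
    by move=> ?; congr (_ < _); lia.
  by move=> p /=; rewrite ltnNge.
rewrite (permP (column_gap_perm sd s0d)) count_filter.
apply: eq_in_count => g; rewrite mem_iota add0n => /andP[_ gh] /=.
(* The hooks listed before h are larger than h, hence than g. *)
congr (_ && ~~ _); rewrite -[in RHS](cat_take_drop i s) ds mem_cat inE.
rewrite (ltn_eqF gh) /=; suff -> : (g \in take i s) = false by [].
apply/negP => gt; move: ss; rewrite -(cat_take_drop i s) ds.
rewrite sorted_pairwise; last by move=> ? ? ? /=; lia.
rewrite pairwise_cat => /and3P[/allrelP/(_ _ h gt) + _ _].
by rewrite inE eqxx => /(_ isT) /=; lia.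
Qed.

Lemma m_rowsE (m : nat) (s : seq nat) :
  sorted gtn s -> all (leq 1) s ->
  [seq nth 0 s i | i <- m_rows m (partition_of_hooks s)] =
  [seq h <- s | all (fun h' => (h' == h %[mod m]) ==> (h' <= h)) s].
Proof.
move=> ss s0; set p := fun h => all _ s.
rewrite -[in RHS](mkseq_nth 0 s) /mkseq filter_map /m_rows.
rewrite size_partition_of_hooks; congr map; apply: eq_in_filter => i.
rewrite mem_iota add0n => /andP[_ ltis] /=.
rewrite /p -[s in RHS](mkseq_nth 0 s) all_map nth_mkseq //.
apply: eq_in_all => i'; rewrite mem_iota add0n => /andP[_ ltis'] /=.
by rewrite !nth_first_column.
Qed.

(** * Counting the gaps of a simultaneous core *)

(** The abacus form of being an m-core: [s] is then the set of first-column
    hook lengths of a partition without hook length m. *)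
Definition core_hooks (m : nat) (s : seq nat) : Prop :=
  0 \notin s /\ (forall n, m <= n -> n \in s -> n - m \in s).

Lemma core_hooksMn (m j n : nat) (s : seq nat) :
  core_hooks m s -> n + j * m \in s -> n \in s.
Proof.
case=> _ sm; elim: j => [|j IH]; first by rewrite mul0n addn0.
move=> ns; apply: IH; have := sm _ _ ns; rewrite mulSn.
by rewrite (_ : n + (m + j * m) - m = n + j * m); [apply|]; lia.
Qed.

Lemma core_hooks_mul (m j : nat) (s : seq nat) :
  core_hooks m s -> j * m \notin s.
Proof.
move=> ms; apply: (contra (@core_hooksMn m j 0 s ms)); exact: ms.1.
Qed.

Lemma core_top_hook (m h : nat) (s : seq nat) :
  0 < m -> core_hooks m s ->
  all (fun h' => (h' == h %[mod m]) ==> (h' <= h)) s = (h + m \notin s).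
Proof.
move=> m0 ms; apply/idP/idP.
  move=> /allP H; apply/negP => /H; rewrite modnDr eqxx /=; lia.
move=> hm; apply/allP => h' h's; apply/implyP => /eqP e.
rewrite leqNgt; apply: contra hm => hh'.
have /dvdnP[[|j] jE] : m %| h' - h by rewrite -eqn_mod_dvd 1?ltnW // e.
  lia.
by apply: (@core_hooksMn m j) => //; rewrite (_ : _ + _ = h') //; lia.
Qed.

Definition gaps (s : seq nat) (m n : nat) : nat :=
  count (fun g => g \notin s) (iota m n).

Lemma gapsD (s : seq nat) (m n p : nat) :
  gaps s m (n + p) = gaps s m n + gaps s (m + n) p.
Proof. by rewrite /gaps iotaD count_cat. Qed.

(** In each residue class the hooks of an m-core form an initial segment, so a
    class whose top hook is above [c] meets the m integers after [c] in exactly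
    one hook.  The proof counts instead: translation by m is a bijection from
    the hooks above [c] that are not on top to the hooks above [c + m]. *)
Lemma count_top_hooks (m c : nat) (s : seq nat) :
  uniq s -> core_hooks m s ->
  count (fun h => (h + m \notin s) && (c < h)) s + gaps s c.+1 m = m.
Proof.
move=> us ms.
have e1 := count_predC (fun h => h + m \in s) [seq h <- s | c < h].
have e2 := count_predC (fun h => c + m < h) [seq h <- s | c < h].
have e3 := count_predC (fun h => h \in s) (iota c.+1 m).
rewrite size_iota in e3.
have e4 : count (fun h => h + m \in s) [seq h <- s | c < h] =
          count (fun h => c + m < h) [seq h <- s | c < h].
  rewrite -!size_filter -(size_map (addn^~ m)); apply: perm_size.
  apply: uniq_perm.
  - by rewrite map_inj_uniq ?filter_uniq //; exact: addIn.
  - by rewrite !filter_uniq.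
  - move=> h; rewrite !mem_filter; apply/mapP/and3P.
      by case=> g; rewrite !mem_filter => /and3P[gm cg gs] ->; split=> //; lia.
    case=> cmh ch hs; exists (h - m); last by rewrite subnK //; lia.
    by rewrite !mem_filter subnK ?hs ?ms.2 ?andbT //=; lia.
have e5 : count (predC (fun h => c + m < h)) [seq h <- s | c < h] =
          count (fun h => h \in s) (iota c.+1 m).
  rewrite -!size_filter; apply: perm_size; apply: uniq_perm.
  - by rewrite !filter_uniq.
  - by rewrite filter_uniq ?iota_uniq.
  - move=> h; rewrite !mem_filter mem_iota /=.
    by rewrite -leqNgt addSn ltnS; case: (h \in s); rewrite ?andbF ?andbT //= andbC.
rewrite /gaps.
have -> : count (fun h => (h + m \notin s) && (c < h)) s =
  count (predC (fun h => h + m \in s)) [seq h <- s | c < h].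
  by rewrite count_filter.
move: e3; rewrite (eq_count (a1 := predC _) (a2 := fun g => g \notin s)) //.
lia.
Qed.

Lemma gaps_slide (s : seq nat) (m n : nat) :
  (m \notin s) + gaps s m.+1 n = gaps s m n + (m + n \notin s).
Proof.
transitivity (gaps s m (1 + n)).
  by rewrite gapsD addn1 /gaps /= addn0.
by rewrite addnC gapsD /gaps /= addn0.
Qed.

(** Sliding a window whose length is a multiple of a can only gain gaps, since
    the integer that enters is a gap if the one that leaves is. *)
Lemma gaps_shift_le (a k m t : nat) (s : seq nat) :
  core_hooks a s -> gaps s m (a * k) <= gaps s (m + t) (a * k).
Proof.
move=> sa; elim: t => [|t /leq_trans->//]; first by rewrite addn0.
rewrite addnS; have := gaps_slide s (m + t) (a * k).
suff : (m + t \notin s) <= (m + t + a * k \notin s) by lia.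
case: (boolP (m + t + a * k \in s)) => [|_]; last by case: (_ \notin _).
by rewrite mulnC => /(core_hooksMn sa) ->.
Qed.

(** While the window slides up to a hook t, either a hook leaves as a gap
    enters at the last step, or t + a k is a hook and subtracting b = a k + 1
    gives the hook t - 1; this descent must stop, because 0 is not a hook. *)
Lemma gaps_shift_lt (a k t : nat) (s : seq nat) :
  core_hooks a s -> core_hooks (a * k + 1) s -> t \in s ->
  gaps s 1 (a * k) < gaps s t.+1 (a * k).
Proof.
move=> sa sb; elim: t => [|t IH] ts; first by move: sa.1; rewrite ts.
have := gaps_slide s t.+1 (a * k); rewrite ts /= add0n => ->.
have [bs|_] := boolP (t.+1 + a * k \in s) => /=.
  rewrite addn0; apply: IH.
  by have := sb.2 _ _ bs; rewrite (_ : t.+1 + _ - _ = t); [apply|]; lia.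
by rewrite addn1 ltnS -[t.+1]add1n gaps_shift_le.
Qed.

(** For [h < b] the gaps counted are all those below [h].  They include 0, which
    is outside [1, a i], but when [h <= a * i] the gap [a * i] is not below [h]
    and makes up for it.  For [h >= b], [gaps_shift_lt] applies at the hook
    [h - b]. *)
Lemma boundary_gaps_le (a k i h : nat) (s : seq nat) :
  core_hooks a s -> core_hooks (a * k + 1) s -> i <= k -> h \in s ->
  (boundary_gaps (a * k + 1) s h <= gaps s 1 (a * i)) = (h <= a * i).
Proof.
move=> sa sb ik hs.
have h0 : 0 < h by case: h hs => // s0; have := sa.1; rewrite s0.
have ia_k : a * i <= a * k by rewrite leq_mul2l ik orbT.
have [hb|bh] := ltnP h (a * k + 1).
  have -> : boundary_gaps (a * k + 1) s h = (gaps s 1 h.-1).+1.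
    rewrite /boundary_gaps -{2}(prednK h0) /= sa.1 subn0 hb /= add1n.
    congr _.+1; rewrite /gaps; apply: eq_in_count => g.
    by rewrite mem_iota => gh; rewrite (_ : h - g < _) //; lia.
  case: (leqP h (a * i)) => hi.
    have hni : h != a * i.
      apply: contraTneq hs => ->; rewrite mulnC; exact: core_hooks_mul.
    have [d dE] : exists d, a * i = h.-1 + d + 1.
      by exists (a * i - h); lia.
    rewrite dE gapsD [X in _ <= _ + X](_ : _ = 1) ?addn1 ?ltnS.
      by rewrite gapsD leq_addr.
    rewrite /gaps /= addn0 (_ : 1 + _ = i * a) ?core_hooks_mul //.
    by rewrite [RHS]mulnC dE; lia.
  have -> : h.-1 = a * i + (h.-1 - a * i) by lia.
  by rewrite gapsD ltnNge leq_addr.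
have -> : boundary_gaps (a * k + 1) s h
          = gaps s (h - (a * k + 1)).+1 (a * k).
  rewrite /boundary_gaps /gaps.
  have -> : iota 0 h = iota 0 ((h - (a * k + 1)).+1 + a * k).
    by congr iota; lia.
  rewrite iotaD count_cat add0n [X in X + _](_ : _ = 0).
    apply: eq_in_count => g; rewrite mem_iota => gh.
    by rewrite (_ : h - g < _) //; lia.
  apply/eqP; rewrite -leqn0 leqNgt -has_count; apply/hasPn => g.
  by rewrite mem_iota negb_and => gh; apply/orP; left; lia.
have := gaps_shift_lt sa sb (sb.2 _ bh hs).
have -> : a * k = a * i + (a * k - a * i) by lia.
by rewrite gapsD => H; rewrite [RHS](_ : _ = false); lia.
Qed.

(** * The heights of a path given by its rows *)

Lemma east_starts_nseq_cat (n x y : nat) (P : lattice_path) :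
  (x, y) \in east_starts (nseq n east ++ P) ->
  (x < n) && (y == 0) || (n <= x) && ((x - n, y) \in east_starts P).
Proof.
elim: n x y => [|n IH] x y /=; first by rewrite subn0.
rewrite east_starts_cons /= inE => /orP[/eqP[-> ->] //|/mapP[[u w] /IH +[-> ->]]].
by rewrite subSS !ltnS.
Qed.

Lemma east_starts_path_of_rows (b z x y : nat) (r : seq nat) :
  path leq z r -> (x, y) \in east_starts (path_of_rows b z r) ->
  y = count (fun l => l <= x + z) r.
Proof.
elim: r z x y => [|l r IH] z x y /=.
  move=> _; rewrite -[nseq _ _]cats0 => /east_starts_nseq_cat.
  by rewrite andbF orbF => /andP[_ /eqP].
case/andP=> zl lr /east_starts_nseq_cat /orP[/andP[xl /eqP ->]|/andP[lx]].
  symmetry; apply/eqP; rewrite -leqn0 leqNgt.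
  rewrite (_ : l <= x + z = false) ?add0n -?has_count; last by lia.
  apply/hasPn => l' l'r; rewrite -ltnNge.
  move: lr; rewrite (path_sortedE leq_trans) => /andP[/allP/(_ _ l'r) ? _].
  by lia.
rewrite east_starts_cons /= => /mapP[[u w] uw [xu ->]].
rewrite (IH _ _ _ lr uw) (_ : l <= x + z) ?add1n; last by lia.
by congr _.+1; apply: eq_count => l' /=; congr (_ <= _); lia.
Qed.

Lemma east_starts_path_of_partition (b x y : nat) (lambda : seq nat) :
  sorted geq lambda ->
  (x, y) \in east_starts (path_of_partition b lambda) ->
  y = count (fun l => l <= x) lambda.
Proof.
move=> sl /east_starts_path_of_rows ->; first by rewrite addn0 count_rev.
by rewrite path_min_sorted ?rev_sorted //; apply/allP.
Qed.

(** * Levels and positive hooks of a Dyck path *)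

Lemma lattice_point_sum (P : lattice_path) (i : nat) :
  i <= size P -> (lattice_point P i).1 + (lattice_point P i).2 = i.
Proof.
move=> iP; rewrite -[RHS](size_takel iP) /=.
rewrite -[RHS](count_predC (pred1 north)) addnC; congr addn.
by apply: eq_count => -[].
Qed.

Lemma lattice_point_mono (P : lattice_path) (i j : nat) : i <= j ->
  (lattice_point P i).1 <= (lattice_point P j).1 /\
  (lattice_point P i).2 <= (lattice_point P j).2.
Proof.
move=> ij; have -> : j = i + (j - i) by rewrite subnKC.
by rewrite /lattice_point /= takeD !count_cat !leq_addr.
Qed.

Lemma lattice_point_size (P : lattice_path) :
  lattice_point P (size P) = endpoint P.
Proof. by rewrite /lattice_point take_size. Qed.

(** Being southeast of some point of the path, in place of the point directly
    above the box, makes the moves of a box southwards or eastwards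
    immediate. *)
Lemma box_belowP (P : lattice_path) (x y : nat) : 0 < x <= (endpoint P).1 ->
  reflect (exists2 i, i <= size P &
             (lattice_point P i).1 < x /\ y < (lattice_point P i).2)
          (box_below P (x, y)).
Proof.
move=> /andP[x0 xP].
apply: (iffP hasP) => [[e /mapP[i + ->]]|[i iP [ix yi]]].
  rewrite mem_filter mem_iota => /and3P[_ _ iP] /andP[/eqP /= <- yi].
  by exists i => //; exact: ltnW.
have [|z _ zE] := @east_starts_ex P x.-1; first by rewrite prednK.
exists (x.-1, z) => //=; rewrite prednK // eqxx /=.
move: zE => /mapP[j]; rewrite mem_filter mem_iota => /and3P[jE _ jP] e.
have [ij|ji] := leqP i j.
  by have [_] := lattice_point_mono P ij; rewrite -e /=; exact: leq_trans.
have [+ _] := lattice_point_mono P ji.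
rewrite /lattice_point (take_nth north) // (eqP jE) /= -cats1 count_cat /=.
move: e ix; rewrite /lattice_point /endpoint => -[<- _] /=; lia.
Qed.

Lemma dyck_pathP (a b : nat) (P : lattice_path) : dyck_path a b P ->
  endpoint P = (b, a) /\
  (forall i, i <= size P ->
     a * (lattice_point P i).1 <= b * (lattice_point P i).2).
Proof.
move=> /andP[/eqP eP /allP aP]; split=> // i iP.
by apply: aP; rewrite mem_iota.
Qed.

Lemma dyck_path_size (a b : nat) (P : lattice_path) : dyck_path a b P ->
  size P = a + b.
Proof.
case/dyck_pathP => eP _; have := lattice_point_sum (leqnn (size P)).
by rewrite lattice_point_size eP /= => <-; rewrite addnC.
Qed.

Lemma positive_hooksP (a b n : nat) (P : lattice_path) : dyck_path a b P ->
  reflect (exists x y i, [/\ 0 < x <= b, y < a, 0 < n /\ n + a * x = b * y,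
             i <= size P &
             (lattice_point P i).1 < x /\ y < (lattice_point P i).2])
          (n \in positive_hooks a b P).
Proof.
move=> /dyck_pathP[eP _]; apply: (iffP mapP) => [[[x y]]|[x [y [i]]]].
  rewrite mem_filter => /andP[/andP[]] => bel lev.
  move=> /allpairsP[[x' y'] [/=]]; rewrite !mem_iota => x'b y'a [ex ey].
  rewrite -{}ex -{}ey in x'b y'a => nE; rewrite /level /= in nE lev.
  have /box_belowP[|i iP iE] := bel; first by rewrite eP /=; lia.
  by exists x, y, i; split=> //; first lia; lia.
move=> [xb ya [n0 nE] iP iE]; exists (x, y); last by rewrite /level /=; lia.
rewrite mem_filter /level /=; apply/andP; split.
  apply/andP; split; last lia.
  by apply/box_belowP; [rewrite eP|exists i].
by apply/allpairsP; exists (x, y); rewrite !mem_iota; split=> //=; lia.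
Qed.

Lemma coprime_mul_eq (a b x y : nat) :
  0 < a -> coprime a b -> b * y = a * x -> exists q, y = q * a /\ x = b * q.
Proof.
move=> a0 ab e; have : a %| b * y by rewrite e dvdn_mulr.
rewrite Gauss_dvdr // => /dvdnP[q qE]; exists q; split=> //.
by move: e; rewrite qE; nia.
Qed.

(** Subtracting a moves the box one step east.  The box stays in the grid, as
    the fillings of the last column are negative. *)
Lemma positive_hooks_acore (a b : nat) (P : lattice_path) :
  0 < a -> dyck_path a b P -> coprime a b -> core_hooks a (positive_hooks a b P).
Proof.
move=> a0 dP ab; split.
  by apply/negP => /(positive_hooksP _ dP)[x [y [i [_ _ []]]]].
move=> n an /(positive_hooksP _ dP)[x [y [i [xb ya [n0 nE] iP [ix yi]]]]].
apply/(positive_hooksP _ dP); exists x.+1, y, i; split=> //.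
- apply/andP; split=> //; rewrite ltnNge; apply/negP => bx.
  have : b * y <= b * a - b.
    by rewrite -[X in _ - X]muln1 -mulnBr leq_mul2l; apply/orP; right; lia.
  have : a * b <= a * x by rewrite leq_mul2l bx orbT.
  nia.
- split; last by rewrite mulnS; lia.
  rewrite subn_gt0 ltn_neqAle an andbT; apply/negP => /eqP na.
  have [|[|q] [qE _]] := @coprime_mul_eq a b x.+1 y a0 ab.
  - by rewrite -nE -na mulnS.
  - by rewrite qE in nE; nia.
  - by rewrite qE in ya; nia.
- by split=> //; lia.
Qed.

(** Subtracting b moves the box one step south. *)
Lemma positive_hooks_bcore (a b : nat) (P : lattice_path) :
  0 < a -> dyck_path a b P -> coprime a b -> core_hooks b (positive_hooks a b P).
Proof.
move=> a0 dP ab; split.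
  by apply/negP => /(positive_hooksP _ dP)[x [y [i [_ _ []]]]].
move=> n bn /(positive_hooksP _ dP)[x [y [i [xb ya [n0 nE] iP [ix yi]]]]].
case: y ya yi nE => [|y] ya yi nE; first by nia.
apply/(positive_hooksP _ dP); exists x, y, i; split=> //; first lia.
  split; last by rewrite mulnS in nE; lia.
  rewrite subn_gt0 ltn_neqAle bn andbT; apply/negP => /eqP nb.
  have ey : a * x = b * y by rewrite mulnS in nE; lia.
  have [[|q] [qE _]] := coprime_mul_eq a0 ab (esym ey).
  - by rewrite qE in ey; nia.
  - by rewrite qE in ya; nia.
by split=> //; lia.
Qed.

Lemma levels_uniq (a b : nat) (P : lattice_path) :
  0 < a -> dyck_path a b P -> coprime a b -> uniq (levels a b P).
Proof.
move=> a0 dP ab; have [eP _] := dyck_pathP dP.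
rewrite map_inj_in_uniq ?iota_uniq // => i j.
wlog ij : i j / i <= j.
  by move=> W iI jI e; have [/W|/ltnW/W->] := leqP i j; first exact.
rewrite !mem_iota /level => iP jP.
have [xij yij] := lattice_point_mono P ij.
have si := @lattice_point_sum P i; have sj := @lattice_point_sum P j.
have sP := dyck_path_size dP.
have [_ yj] : (lattice_point P j).1 <= b /\ (lattice_point P j).2 <= a.
  have : j <= size P by lia.
  by move=> /(lattice_point_mono P); rewrite lattice_point_size eP.
move: (lattice_point P i) (lattice_point P j) xij yij si sj yj.
move=> [xi yi] [xj yj] /= xij yij si sj yja e.
have e' : b * (yj - yi) = a * (xj - xi) by rewrite !mulnBr; lia.
(* Distinct points of equal level are the two ends of the path, but the last
   one carries no level. *)
have [[|q] [qE e'']] := coprime_mul_eq a0 ab e'; first by lia.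
have : a <= yj - yi by rewrite qE mulSn leq_addr.
have : b <= xj - xi by rewrite e'' mulnS leq_addr.
lia.
Qed.

(** Since a and b are coprime, a box of the grid with the level of a point of
    the path has that point as its southeast corner. *)
Lemma level_notin_hooks (a b n i : nat) (P : lattice_path) :
  0 < a -> dyck_path a b P -> coprime a b -> i <= size P ->
  level a b (lattice_point P i) = n%:Z%R -> n \notin positive_hooks a b P.
Proof.
move=> a0 dP ab iP; have [eP aP] := dyck_pathP dP.
rewrite /level => nL.
apply/negP => /(positive_hooksP _ dP)[x [y [j [xb ya [n0 nE] jP [jx yj]]]]].
have e : b * (lattice_point P i).2 + a * x = a * (lattice_point P i).1 + b * y.
  by have := aP i iP; lia.
have yi : (lattice_point P i).2 <= a.
  by have [_] := lattice_point_mono P iP; rewrite lattice_point_size eP.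
have xi : (lattice_point P i).1 <= b.
  by have [] := lattice_point_mono P iP; rewrite lattice_point_size eP.
have [yiy|yiy] := leqP (lattice_point P i).2 y.
  have e' : b * (y - (lattice_point P i).2) = a * (x - (lattice_point P i).1).
    by rewrite !mulnBr; lia.
  have [[|q] [qE _]] := coprime_mul_eq a0 ab e'; last by nia.
  have eyi : (lattice_point P i).2 = y by lia.
  have exi : (lattice_point P i).1 = x by rewrite eyi in e; nia.
  (* The corner (x, y) would be both on the path and southeast of it. *)
  have [ij|ji] := leqP i j.
    by have [] := lattice_point_mono P ij; lia.
  by have [] := lattice_point_mono P (ltnW ji); lia.
have e' : b * ((lattice_point P i).2 - y) = a * ((lattice_point P i).1 - x).
  by rewrite !mulnBr; lia.
have [[|q] [qE e'']] := coprime_mul_eq a0 ab e'; first by lia.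
by rewrite mulnS in e''; lia.
Qed.

(** The point of the path on the antidiagonal of a grid point (x, y) of level n
    is either (x, y) itself, or northwest of it, making n a hook when n is
    positive, or southeast of it, forcing n >= a + b by the Dyck condition. *)
Lemma small_gap_level (a k n : nat) (P : lattice_path) :
  0 < a -> dyck_path a (a * k + 1) P -> n < a + (a * k + 1) ->
  n \notin positive_hooks a (a * k + 1) P ->
  n%:Z%R \in levels a (a * k + 1) P.
Proof.
move=> a0 dP nab nH; have [eP aP] := dyck_pathP dP.
have sP := dyck_path_size dP.
case: (posnP n) => [-> {nH nab}|n0].
  apply/mapP; exists 0; first by rewrite mem_iota sP; lia.
  by rewrite /level /lattice_point take0 /=; lia.
suff [x [y [xb ya nE xy]]] : exists x y, [/\ x <= a * k + 1, y <= a,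
    n + a * x = (a * k + 1) * y & x + y < a + (a * k + 1)].
  apply/mapP; exists (x + y); first by rewrite mem_iota sP.
  have s : x + y <= size P by lia.
  have e := lattice_point_sum s; have d := aP _ s.
  suff ex : (lattice_point P (x + y)).1 = x.
    rewrite /level ex (_ : (lattice_point P (x + y)).2 = y); last lia.
    by lia.
  have m := lattice_point_mono P s; rewrite lattice_point_size eP in m.
  case: (ltngtP (lattice_point P (x + y)).1 x) => // lt; last by nia.
  case/negP: nH; apply/(positive_hooksP _ dP).
  have {m}[_ m] : _ /\ (lattice_point P (x + y)).2 <= a := m.
  by exists x, y, (x + y); split=> //; lia.
(* As b is 1 modulo a, the height is the residue of n, taken in [1, a]. *)
have nE := divn_eq n a; have ra := ltn_pmod n a0.
case: (posnP (n %% a)) => [r0|r0].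
  exists (a * k + 1 - n %/ a), a.
  have q0 : 0 < n %/ a by nia.
  have qk : n %/ a <= k.+1 by nia.
  have qb : n %/ a <= a * k + 1 by nia.
  by split=> //; [lia|rewrite mulnBr; nia|lia].
have qk : n %/ a <= k by nia.
by exists (k * (n %% a) - n %/ a), (n %% a); split; nia.
Qed.

Lemma delta_gaps (a k : nat) (P : lattice_path) :
  0 < a -> dyck_path a (a * k + 1) P ->
  delta a (a * k + 1) P =
  gaps (positive_hooks a (a * k + 1) P) 0 (a + (a * k + 1)).
Proof.
move=> a0 dP.
have ab : coprime a (a * k + 1) by rewrite /coprime mulnC gcdnMDl gcdn1.
have [_ aP] := dyck_pathP dP.
rewrite /delta /gaps -!size_filter -[RHS](size_map Posz).
apply: perm_size; apply: uniq_perm.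
- by rewrite filter_uniq // levels_uniq.
- by rewrite map_inj_uniq ?filter_uniq ?iota_uniq // => ? ? [].
- move=> l; rewrite mem_filter; apply/andP/mapP.
    move=> [lab /mapP[i]]; rewrite mem_iota => iP lE.
    have l0 : l = `|l|%N%:Z%R.
      by rewrite lE /level; have := aP i; lia.
    exists `|l|%N => //; rewrite mem_filter mem_iota.
    rewrite (@level_notin_hooks _ _ _ i) //=; [lia|lia|].
    by rewrite -l0 lE.
  move=> [n]; rewrite mem_filter mem_iota => /andP[nH nab] ->.
  by split; [lia|apply: small_gap_level].
Qed.

(** * The bounce path of the zeta image *)

(** The parts exceeding the given number come from the top hooks above [a * i],
    counted by [count_top_hooks]; the padding brings the number of parts
    to [a]. *)
Lemma count_zeta_partition (a k i : nat) (P : lattice_path) :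
  let b := a * k + 1 in
  0 < a -> i <= k -> dyck_path a b P ->
  count (fun l => l <= gaps (positive_hooks a b P) 1 (a * i))
        (zeta_partition a b P) =
  gaps (positive_hooks a b P) (a * i).+1 a.
Proof.
move=> b a0 ik dP.
have ab : coprime a b by rewrite /coprime /b mulnC gcdnMDl gcdn1.
have Ha := positive_hooks_acore a0 dP ab.
have Hb : core_hooks b (positive_hooks a b P).
  exact: positive_hooks_bcore.
set H := positive_hooks a b P in Ha Hb *.
pose s := sort geq (undup H).
have sH : s =i H by move=> h; rewrite mem_sort mem_undup.
have gE m n : gaps H m n = gaps s m n.
  by apply: eq_count => g; rewrite sH.
have coreE m : core_hooks m H -> core_hooks m s.
  by case=> H0 Hm; split=> [|n]; rewrite !sH //; exact: Hm.
have us : uniq s by rewrite sort_uniq undup_uniq.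
have ss : sorted gtn s.
  rewrite gtn_sorted_uniq_geq us sort_sorted // => x y /=; exact: leq_total.
have s0 : all (leq 1) s.
  by apply/allP => -[|//] h0; move: Ha.1; rewrite -sH h0.
have [_ fE] := first_column_hooksK ss s0.
have rowsE := m_rowsE a ss s0.
rewrite !gE /zeta_partition /core -/H -/s count_cat count_sort count_nseq.
rewrite leq0n mul1n size_sort size_map.
have sm : size (m_rows a (partition_of_hooks s)) <= a.
  by rewrite size_m_rows // fE.
have topE : {in s, (fun h => all (fun h' => (h' == h %[mod a]) ==> (h' <= h)) s)
    =1 (fun h => h + a \notin s)}.
  by move=> h _; apply: core_top_hook => //; exact: coreE.
have szE : size (m_rows a (partition_of_hooks s)) =
    count (fun h => h + a \notin s) s.
  by rewrite -(size_map (nth 0 s)) rowsE size_filter; apply: eq_in_count.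
have -> : count (fun l => l <= gaps s 1 (a * i))
    [seq m_boundary_in_row b (partition_of_hooks s) j
       | j <- m_rows a (partition_of_hooks s)] =
    count (fun h => (h + a \notin s) && (h <= a * i)) s.
  rewrite (_ : map _ _ =
    [seq boundary_gaps b s h | h <- [seq nth 0 s j
       | j <- m_rows a (partition_of_hooks s)]]); last first.
    rewrite -map_comp; apply/eq_in_map => j.
    rewrite mem_filter mem_iota size_partition_of_hooks => /and3P[_ _ js].
    exact: m_boundary_in_rowE.
  rewrite rowsE count_map count_filter; apply: eq_in_count => h hs /=.
  rewrite boundary_gaps_le //; [|exact: coreE|exact: coreE].
  by rewrite andbC; congr (_ && _); exact: topE.
have top := count_top_hooks (a * i) us (coreE _ Ha).
have part : count (fun h => h + a \notin s) s =
  count (fun h => (h + a \notin s) && (h <= a * i)) s +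
  count (fun h => (h + a \notin s) && (a * i < h)) s.
  rewrite -!size_filter -(count_predC (fun h => h <= a * i)) -!size_filter.
  by rewrite -!filter_predI; congr (_ + _); congr size; apply: eq_filter => h /=;
    rewrite andbC // ltnNge.
lia.
Qed.

Theorem corollary9p15 (a k : nat) (P : lattice_path) (v h : seq nat) :
  2 <= a ->
  dyck_path a (a * k + 1) P ->
  initial_bounce_path k (zeta a (a * k + 1) P) v h ->
  delta a (a * k + 1) P = sumn v + sumn h + 1.
Proof.
move=> a2 dP [sv sh vE hE]; have a0 : 0 < a by lia.
set b := a * k + 1 in dP vE *; pose H := positive_hooks a b P.
have [_ sz _] := zeta_partitionP b P a0.
have vertical i : i < k.+1 -> sumn (take i h) = gaps H 1 (a * i) ->
    sumn (take i.+1 v) = gaps H (a * i).+1 a.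
  move=> ik e; rewrite (east_starts_path_of_partition sz (vE i ik)) e.
  exact: count_zeta_partition.
have horizontal i : i <= k -> sumn (take i h) = gaps H 1 (a * i).
  elim: i => [|i IH] ik; first by rewrite take0 muln0.
  rewrite (take_nth 0) ?sh // sumn_rcons IH 1?ltnW // hE //.
  rewrite vertical ?IH 1?ltnW //.
  by rewrite [in RHS]mulnS [in RHS]addnC gapsD.
have vk := vertical k (ltnSn k) (horizontal k (leqnn k)).
have hk := horizontal k (leqnn k).
rewrite !take_oversize ?sv ?sh // in vk hk.
have H0 : 0 \notin H by apply/negP => /(positive_hooksP _ dP)[x [y [i [_ _ []]]]].
rewrite delta_gaps // vk hk -/b -/H.
have -> : a + b = 1 + (a * k + a) by rewrite /b; lia.
rewrite !gapsD add0n add1n [gaps H 0 1](_ : _ = 1); first lia.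
by rewrite /gaps /= H0.
Qed.
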